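(* For any integer $k\geq 1$, any $i\in\{1,\dots,k\}$ and any integer $n\geq 0$, the number of partitions of $n$ into parts that are not congruent to $2$ modulo $4$ and not congruent to $0$, $2k+(2i-1)$ or $2k-(2i-1)$ modulo $4k$ equals the number of partitions $(b_1,\dots,b_s)$ of $n$, with $b_1\geq b_2\geq\cdots\geq b_s$, such that no odd part is repeated, $b_p-b_{p+k-1}\geq 2$ whenever $p+k-1\leq s$ and $b_p$ is odd, $b_p-b_{p+k-1}>2$ whenever $p+k-1\leq s$ and $b_p$ is even, and at most $k-i$ parts are equal to $1$ or $2$. *)

(* Defs.v *)
From HB Require Import structures.
From mathcomp Require Import all_boot.

Set Implicit Arguments.
Unset Strict Implicit.
Unset Printing Implicit Defensive.

Definition is_part_of (n : nat) (b : seq nat) : bool :=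
  [&& sorted geq b, 0 \notin b & sumn b == n].

(* The empty sequence is the only partition of 0. *)
Record intpart (n : nat) : Type :=
  IntPart { parts :> seq nat; partsP : is_part_of n parts }.

HB.instance Definition _ n := [isSub for @parts n].
HB.instance Definition _ n := [Countable of intpart n by <:].

Section Finiteness.

Variable n : nat.

Lemma leq_part_sumn (b : seq nat) c : c \in b -> c <= sumn b.
Proof.
elim: b => //= a b IHb; rewrite inE => /predU1P[->|/IHb le_c].
  exact: leq_addr.
exact: leq_trans le_c (leq_addl _ _).
Qed.

Lemma size_leq_sumn (b : seq nat) : 0 \notin b -> size b <= sumn b.
Proof.
elim: b => //= a b IHb; rewrite inE negb_or eq_sym -lt0n => /andP[a0 /IHb le_b].
by rewrite -add1n leq_add.
Qed.

(* A partition of n has at most n parts, each at most n. *)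
Definition enum_intpart : seq (intpart n) :=
  undup (pmap insub [seq map val (val s) | s : {bseq n of 'I_n.+1}]).

Lemma enum_intpartP : Finite.axiom enum_intpart.
Proof.
apply: Finite.uniq_enumP; first exact: undup_uniq.
move=> b; rewrite mem_undup mem_pmap_sub /=.
have /and3P[_ b0 /eqP sum_b] := partsP b.
have size_b : size (map (@inord n) b) <= n.
  by rewrite size_map -[X in _ <= X]sum_b size_leq_sumn.
apply/imageP; exists (Bseq size_b) => //=.
rewrite -map_comp -[LHS]map_id; apply/eq_in_map => c bc /=.
by rewrite inordK // ltnS -sum_b leq_part_sumn.
Qed.

HB.instance Definition _ := isFinite.Build (intpart n) enum_intpartP.

End Finiteness.

Definition congruence_parts (k i : nat) (b : seq nat) : bool :=
  all (fun c => [&& c != 2 %[mod 4],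
                    c != 0 %[mod 4 * k],
                    c != 2 * k + (2 * i - 1) %[mod 4 * k] &
                    c != 2 * k - (2 * i - 1) %[mod 4 * k]]) b.

(* Positions are counted from 0 here: nth 0 b p is the part b_(p+1), so      *)
(* p + k.-1 < size b is the condition that the part k-1 places later exists. *)
Definition difference_parts (k : nat) (b : seq nat) : bool :=
  [forall p : 'I_(size b), (p + k.-1 < size b) ==>
     let d := nth 0 b p - nth 0 b (p + k.-1) in
     if odd (nth 0 b p) then d >= 2 else d > 2].

Definition gordon_parts (k i : nat) (b : seq nat) : bool :=
  [&& uniq [seq c <- b | odd c],
      difference_parts k b &
      count (pred2 1 2) b <= k - i].

(* Main.v *)
Require Import Defs.
From mathcomp Require Import all_boot.
From mathcomp Require Import all_algebra zify ring.

(* Write p := k - i + 1. The difference conditions say that odd parts are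
   distinct and that any three consecutive values 2j, 2j+1, 2j+2 occur fewer
   than k times in total, so removing the parts 2m+1 and 2m+2 gives a recursion
   for the generating functions of such partitions with all parts > 2m and fewer
   than p parts equal to 2m+1 or 2m+2. Andrews' functions
   J_{k,p}(-1/q; q^(2m); q^2) obey the same recursion and both tend to 1 as m
   grows, so they agree; at m = 0 Andrews' series is a theta series, which the
   Jacobi triple product turns into the generating function of the partitions
   into parts with the allowed residues.

   Coefficients up to q^n are compared in Z[X]/(X^(n+1)). There q is nilpotent,
   so infinite sums and products are finite ones, and multiplying Andrews' series
   by (q^2; q^2)_oo avoids all division. *)

Set Implicit Arguments.
Unset Strict Implicit.
Unset Printing Implicit Defensive.

Import GRing.Theory.

(** * Gaussian binomials and a finite form of the Jacobi triple product *)

Section JacobiTripleProduct.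

Local Open Scope ring_scope.

Variables (R : comNzRingType).

(** Gaussian binomial coefficients. The q-Pascal rule serves as definition because quotients of
    q-factorials make no sense in an arbitrary ring. *)
Fixpoint qbin (p : R) n m : R := match n, m with
  | _, 0 => 1
  | 0, _.+1 => 0
  | n'.+1, m'.+1 => qbin p n' m' + p ^+ m * qbin p n' m
  end.

Arguments qbin : simpl never.

Lemma qbin0 p n : qbin p n 0 = 1. Proof. by case: n. Qed.

Lemma qbinS p n m : qbin p n.+1 m.+1 = qbin p n m + p ^+ m.+1 * qbin p n m.+1.
Proof. by []. Qed.

Lemma qbin_small p n m : (n < m)%N -> qbin p n m = 0.
Proof.
elim: n m => [|n IHn] [|m] // ltnm.
by rewrite qbinS !IHn ?mulr0 ?addr0 // ltnW.
Qed.

Definition qfact (p : R) n : R := \prod_(0 <= t < n) (1 - p ^+ t.+1).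

Lemma qfactS p n : qfact p n.+1 = qfact p n * (1 - p ^+ n.+1).
Proof. by rewrite /qfact big_nat_recr. Qed.

Lemma qfact0 p : qfact p 0 = 1.
Proof. by rewrite /qfact big_geq. Qed.

(** Division-free form of the quotient formula. In the double induction the q-Pascal rule
    contributes the factors 1 - p^(a+1) and p^(a+1) (1 - p^(b+1)), whose sum is 1 - p^(a+b+2). *)
Lemma qbin_fact p a b :
  qbin p (a + b) a * qfact p a * qfact p b = qfact p (a + b).
Proof.
elim: a b => [|a IHa] b; first by rewrite qbin0 qfact0 !mul1r.
elim: b => [|b IHb].
  rewrite addn0 qfact0 mulr1 qbinS (qbin_small p (ltnSn a)) mulr0 addr0.
  by rewrite qfactS mulrA -[in RHS](addn0 a) -IHa addn0 qfact0 mulr1.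
have Ea := IHa b.+1; rewrite addnS in Ea IHb.
rewrite addSn addnS qbinS.
have -> : qfact p (a + b).+2 = qfact p (a + b).+1 * (1 - p ^+ (a.+1 + b.+1)).
  by rewrite qfactS addSn addnS.
have -> : (qbin p (a + b).+1 a + p ^+ a.+1 * qbin p (a + b).+1 a.+1) *
    qfact p a.+1 * qfact p b.+1 =
    qbin p (a + b).+1 a * qfact p a * qfact p b.+1 * (1 - p ^+ a.+1) +
    qbin p (a + b).+1 a.+1 * qfact p a.+1 * qfact p b * (p ^+ a.+1 * (1 - p ^+ b.+1)).
  by rewrite !qfactS; ring.
by rewrite Ea IHb exprD; ring.
Qed.

Variables (q : R) (c : nat).

(** The q-binomial theorem in base q^(2c) at the point q^a; the even base keeps the exponents
    j(j-1)/2 integral. The factor [t = 0] is split off and the rest is the same product with [a]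
    replaced by [2 * c + a]. *)
Lemma qbin_theorem n a :
  \prod_(0 <= t < n) (1 - q ^+ (2 * c * t + a)) =
  \sum_(0 <= j < n.+1)
     (-1) ^+ j * q ^+ (c * (j * j.-1) + a * j) * qbin (q ^+ (2 * c)) n j.
Proof.
elim: n a => [|n IHn] a; first by rewrite big_geq // big_nat1 !muln0 !mulr1.
rewrite big_nat_recl // big_nat_recl //= qbin0 !muln0 addn0 mul1r add0n.
under eq_bigr => t _.
  rewrite (_ : 2 * c * t.+1 + a = 2 * c * t + (2 * c + a))%N; last lia.
  over.
rewrite IHn.
set s := \sum_(0 <= j < n.+1) _; rewrite mulrBl mul1r {1}/s.
rewrite [in LHS]big_nat_recl //= qbin0 !muln0 mul1r.
have -> : \sum_(0 <= j < n) (-1) ^+ j.+1 *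
   q ^+ (c * (j.+1 * j.+1.-1) + (2 * c + a) * j.+1) * qbin (q ^+ (2 * c)) n j.+1 =
   \sum_(0 <= j < n.+1) (-1) ^+ j.+1 *
   q ^+ (c * (j.+1 * j.+1.-1) + (2 * c + a) * j.+1) * qbin (q ^+ (2 * c)) n j.+1.
  by rewrite big_nat_recr //= [qbin _ n n.+1]qbin_small // mulr0 addr0.
rewrite -addrA; congr (_ + _); first by rewrite mulr1.
rewrite /s mulr_sumr -sumrB; apply: eq_bigr => j _.
rewrite qbinS -exprM.
have -> : (c * (j.+1 * j.+1.-1) + (2 * c + a) * j.+1 =
   c * (j.+1 * j.+1.-1) + a * j.+1 + 2 * c * j.+1)%N by rewrite /=; nia.
have -> : (c * (j.+1 * j.+1.-1) + a * j.+1 =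
   a + (c * (j * j.-1) + (2 * c + a) * j))%N by case: j => [|j] /=; nia.
by rewrite !exprD !exprS; ring.
Qed.

(* The exponent [c * n * (n - 1) + a * n] of the theta series at the possibly
   negative integer [n = j - M]. *)
Definition theta_exp a M j : nat :=
  (if M <= j then c * ((j - M) * (j - M).-1) + a * (j - M)
   else (M - j) * (c * (M - j).+1 - a))%N.

Lemma theta_expSS a M j : theta_exp a M.+1 j.+1 = theta_exp a M j.
Proof. by rewrite /theta_exp ltnS !subSS. Qed.

(** With e(n) = c n (n - 1) + a n and n = j - M, this is e(n + 1) - e(n) = 2 c n + a, arranged
    without negative terms. The bound on [a] keeps the truncated subtractions exact. *)
Lemma theta_exp_step a M j : (a <= 2 * c)%N ->
  (theta_exp a M j + 2 * c * j.+1 =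
   2 * c * M.+1 - a + theta_exp a M j.+1)%N.
Proof.
move=> leac; rewrite /theta_exp.
have [leMj|ltjM] := leqP M j.
  have [n ->] : exists n, (j = M + n)%N by exists (j - M)%N; lia.
  rewrite leqW ?leq_addr // -addnS !addKn /=.
  by case: n => [|n] /=; nia.
have [n ->] : exists n, (M = j.+1 + n)%N by exists (M - j.+1)%N; lia.
case: n => [|n]; first by rewrite addn0 leqnn subnn subSn // subnn; nia.
rewrite ifN; last by lia.
rewrite (_ : j.+1 + n.+1 - j = n.+2)%N; last lia.
rewrite (_ : j.+1 + n.+1 - j.+1 = n.+1)%N; last lia.
have: (a <= c * n.+2)%N by nia.
have: (a <= c * n.+3)%N by nia.
have: (a <= 2 * c * (j.+1 + n.+1).+1)%N by nia.
nia.
Qed.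

Lemma theta_exp0S a M : (a <= 2 * c)%N ->
  theta_exp a M.+1 0 = (2 * c * M.+1 - a + theta_exp a M 0)%N.
Proof.
move=> leac; rewrite /theta_exp ltn0 !subn0 leqn0.
case: M => [|M] /=; first by rewrite subnn; nia.
have: (a <= c * M.+2)%N by nia.
have: (a <= c * M.+3)%N by nia.
have: (a <= 2 * c * M.+2)%N by nia.
nia.
Qed.

(** Induction on [M] from the q-binomial theorem. Multiplying by the new factor produces two
    neighbouring Gaussian binomials, whose exponents [theta_exp_step] adjusts so that the q-Pascal
    rule merges them. *)
Lemma finite_triple_product a M M' : (a <= 2 * c)%N ->
  \prod_(0 <= t < M) (1 - q ^+ (2 * c * t.+1 - a)) *
  \prod_(0 <= t < M') (1 - q ^+ (2 * c * t + a)) =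
  \sum_(0 <= j < (M + M').+1)
     (-1) ^+ (j + M) * q ^+ theta_exp a M j * qbin (q ^+ (2 * c)) (M + M') j.
Proof.
move=> leac; elim: M => [|M IHM].
  rewrite big_geq // mul1r qbin_theorem; apply: eq_bigr => j _.
  by rewrite addn0 /theta_exp leq0n !subn0.
rewrite big_nat_recr //= mulrAC IHM addSn mulrBr mulr1 mulr_suml.
set L := (M + M')%N.
have -> : \sum_(0 <= j < L.+1) (-1) ^+ (j + M) * q ^+ theta_exp a M j *
     qbin (q ^+ (2 * c)) L j * q ^+ (2 * c * M.+1 - a) = 
   \sum_(0 <= j < L.+2) (-1) ^+ (j + M) * q ^+ theta_exp a M j *
     qbin (q ^+ (2 * c)) L j * q ^+ (2 * c * M.+1 - a).
  by rewrite [RHS]big_nat_recr //= [qbin _ _ L.+1]qbin_small // mulr0 mul0r addr0.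
rewrite [in X in _ - X]big_nat_recl // [in RHS]big_nat_recl //= opprD addrCA; congr (_ + _).
  by rewrite !qbin0 theta_exp0S // !exprD exprS; ring.
rewrite -sumrB; apply: eq_bigr => j _.
rewrite theta_expSS -/L.
have E : q ^+ theta_exp a M j * q ^+ (2 * c * j.+1) =
    q ^+ (2 * c * M.+1 - a) * q ^+ theta_exp a M j.+1.
  by rewrite -!exprD theta_exp_step.
transitivity ((-1) ^+ (j + M) * (q ^+ theta_exp a M j * qbin (q ^+ (2 * c)) L j +
    q ^+ (2 * c * M.+1 - a) * q ^+ theta_exp a M j.+1 * qbin (q ^+ (2 * c)) L j.+1)).
  by rewrite addSn exprS; ring.
by rewrite -E qbinS -exprM addSn addnS !exprS; ring.
Qed.

End JacobiTripleProduct.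

(** * The triple product for a nilpotent q *)

Section NilpotentSeries.

Local Open Scope ring_scope.

Variables (R : comNzRingType) (q : R) (N : nat).
Hypothesis qN0 : q ^+ N = 0.

Lemma nilpotent_expr0 e : (N <= e)%N -> q ^+ e = 0.
Proof. by move=> le_Ne; rewrite -(subnK le_Ne) exprD qN0 mulr0. Qed.

(** If x is annihilated then x = q^e x, and iterating gives x = q^(e N) x = 0. Such factors can
    therefore be cancelled. *)
Lemma lreg_1subX e : (0 < e)%N -> GRing.lreg (1 - q ^+ e).
Proof.
move=> e_gt0; apply: mulrI0_lreg => x.
rewrite mulrBl mul1r => /eqP; rewrite subr_eq0 => /eqP Dx.
have {}Dx n : x = q ^+ (e * n) * x.
  elim: n => [|n IHn]; first by rewrite muln0 mul1r.
  by rewrite {1}Dx {1}IHn mulrA -exprD mulnS.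
by rewrite (Dx N) nilpotent_expr0 ?mul0r // leq_pmull.
Qed.

Lemma lreg_prod I (r : seq I) (P : pred I) (F : I -> R) :
  (forall i, P i -> GRing.lreg (F i)) -> GRing.lreg (\prod_(i <- r | P i) F i).
Proof. by move=> regF; elim/big_ind: _ => //; [exact: lreg1 | exact: lregM]. Qed.

Lemma prod_1subX_stable (e : nat -> nat) n : (forall t, t <= e t)%N -> (N <= n)%N ->
  \prod_(0 <= t < n) (1 - q ^+ e t) = \prod_(0 <= t < N) (1 - q ^+ e t).
Proof.
move=> let_e leNn; rewrite (big_cat_nat (leq0n N) leNn) /= [X in _ * X]big_nat_cond.
rewrite [X in _ * X]big1 ?mulr1 // => j /andP[/andP[leNj _] _].
by rewrite nilpotent_expr0 ?subr0 // (leq_trans leNj).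
Qed.

(** The finite form with M = M', multiplied by the infinite product that turns each surviving
    Gaussian binomial into 1. The terms of the bilateral theta series are then paired, n with -n -
    1. *)
Lemma triple_product c a M : (0 < a < 2 * c)%N -> (2 * N <= M)%N ->
  \prod_(0 <= t < M) (1 - q ^+ (2 * c * t.+1 - a)) *
  \prod_(0 <= t < M) (1 - q ^+ (2 * c * t + a)) *
  \prod_(0 <= t < M) (1 - q ^+ (2 * c * t.+1)) =
  \sum_(0 <= n < N) (-1) ^+ n *
     q ^+ (n * (c * n.+1 - a)) * (1 - q ^+ ((2 * n + 1) * a)).
Proof.
case/andP=> a_gt0 ltac le2NM.
rewrite finite_triple_product ?(ltnW ltac) //.
have Dfact n : qfact (q ^+ (2 * c)) n = \prod_(0 <= t < n) (1 - q ^+ (2 * c * t.+1)).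
  by apply: eq_bigr => t _; rewrite -exprM.
have fact_stable n : (N <= n)%N -> qfact (q ^+ (2 * c)) n = qfact (q ^+ (2 * c)) N.
  by move=> leNn; rewrite !Dfact prod_1subX_stable // => t; nia.
have fact_reg : GRing.lreg (qfact (q ^+ (2 * c)) N).
  by rewrite Dfact; apply: lreg_prod => t _; apply: lreg_1subX; nia.
rewrite -Dfact fact_stable; last lia.
(* Near either end of the range the power of q is already 0. Otherwise [j], [M + M - j] and [M + M]
   are all at least [N], so the three q-factorials of [qbin_fact] coincide and one of them
   cancels. *)
have Dj j : (0 <= j < (M + M).+1)%N ->
    q ^+ theta_exp c a M j * qbin (q ^+ (2 * c)) (M + M) j * qfact (q ^+ (2 * c)) N =
    q ^+ theta_exp c a M j.
  move=> ltj; have [leNj|ltjN] := leqP N j; last first.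
    by rewrite nilpotent_expr0 ?mul0r // /theta_exp ifN; [nia | lia].
  have [leNj'|ltjN'] := leqP N (M + M - j); last first.
    rewrite nilpotent_expr0 ?mul0r // /theta_exp ifT; last lia.
    by apply: leq_trans (leq_addl _ _); nia.
  rewrite -mulrA -[RHS]mulr1; congr (_ * _); apply: (fact_reg).
  have := qbin_fact (q ^+ (2 * c)) j (M + M - j).
  rewrite subnKC; last lia.
  rewrite !fact_stable //; last lia.
  by move=> E; rewrite mulr1 -[RHS]E; ring.
rewrite mulr_suml.
under eq_big_nat => j ltj do rewrite -[X in X * _]mulrA -mulrA Dj //.
have trunc K (F : nat -> R) : (N <= K)%N -> (forall n, (N <= n)%N -> F n = 0) ->
    \sum_(0 <= n < K) F n = \sum_(0 <= n < N) F n.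
  move=> leNK F0; rewrite (big_cat_nat (leq0n N) leNK) /= [X in _ + X]big_nat_cond.
  by rewrite [X in _ + X]big1 ?addr0 // => j /andP[/andP[/F0]].
(* The sum is cut after [j = M]: the first half is reindexed by [j = M - n], the second by
   [j = M + 1 + n]. *)
rewrite (big_cat_nat (leq0n M.+1)) ?ltnS ?leq_addl //= big_nat_rev /= add0n.
rewrite -[X in _ + \sum_(X <= _ < _) _]add0n big_addn subSS addnK.
have E1 : \sum_(0 <= n < M.+1) (-1) ^+ (M.+1 - n.+1 + M) *
    q ^+ theta_exp c a M (M.+1 - n.+1) =
  \sum_(0 <= n < M.+1) (-1) ^+ n * q ^+ (n * (c * n.+1 - a)) :> R.
  apply: eq_big_nat => n /andP[_]; rewrite ltnS => leM; rewrite subSS.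
  congr (_ * q ^+ _).
    by rewrite -signr_odd -[RHS]signr_odd; congr (_ ^+ nat_of_bool _); lia.
  rewrite /theta_exp; case: leqP => [leMn|_]; last by rewrite subKn.
  by have -> : n = 0 by [lia]; rewrite subn0 subnn; lia.
have E2 : \sum_(0 <= n < M) (-1) ^+ (n + M.+1 + M) *
    q ^+ theta_exp c a M (n + M.+1) =
  \sum_(0 <= n < M) - ((-1) ^+ n * q ^+ (n * (c * n.+1 - a)) * q ^+ ((2 * n + 1) * a)) :> R.
  apply: eq_big_nat => n _.
  rewrite -mulrA -exprD -mulNr; congr (_ * q ^+ _).
    by rewrite -[RHS]mulN1r -exprS -signr_odd -[RHS]signr_odd; congr (_ ^+ nat_of_bool _); lia.
  rewrite /theta_exp ifT; last lia.
  have -> : (n + M.+1 - M = n.+1)%N by lia.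
  (* For [n = 0] the subtraction [c * n.+1 - a] may truncate, but there it is multiplied by 0. *)
  have: (a <= c * n.+1)%N \/ n = 0%N by nia.
  by case=> [le|->] /=; nia.
have F0 n : (N <= n)%N -> (-1) ^+ n * q ^+ (n * (c * n.+1 - a)) = 0 :> R.
  move=> leNn; rewrite nilpotent_expr0 ?mulr0 // (leq_trans leNn) //.
  by case: n leNn => [|n] _; rewrite ?leqn0 // leq_pmulr; nia.
rewrite E1 E2 (trunc M.+1) ?(trunc M) //; try lia.
- by rewrite -big_split /=; apply: eq_bigr => n _; ring.
- by move=> n leNn; rewrite F0 // mul0r oppr0.
Qed.

(* As q^N = 0, oddP 0 N is (-q; q^2)_oo and evenP 1 N is (q^2; q^2)_oo. *)
Definition oddP a b : R := \prod_(a <= j < b) (1 + q ^+ (2 * j + 1)).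
Definition evenP a b : R := \prod_(a <= j < b) (1 - q ^+ (2 * j)).

Lemma oddPl a : oddP a N = (1 + q ^+ (2 * a + 1)) * oddP a.+1 N.
Proof.
case: (ltnP a N) => aN; first by rewrite /oddP big_ltn.
by rewrite /oddP !big_geq ?nilpotent_expr0 ?addr0 ?mulr1 //; lia.
Qed.

Lemma oddPr a : oddP 0 a.+1 = oddP 0 a * (1 + q ^+ (2 * a + 1)).
Proof. by rewrite /oddP big_nat_recr. Qed.

Lemma evenPr a b : (a <= b)%N ->
  evenP a b.+1 = evenP a b * (1 - q ^+ (2 * b)).
Proof. by move=> ab; rewrite /evenP big_nat_recr. Qed.

Lemma evenPl a b : (a < b)%N ->
  evenP a b = (1 - q ^+ (2 * a)) * evenP a.+1 b.
Proof. by move=> ab; rewrite /evenP big_ltn. Qed.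

(** * Andrews' functions and their recursion *)

Variable k : nat.

(* In Andrews' notation, with x = q^(2m+2),
   hsum m i = (q^2; q^2)_oo * H_{k,i}(-1/q; x; q^2), and with x = q^(2m),
   jsum m i = (q^2; q^2)_oo * J_{k,i}(-1/q; x; q^2). *)
Definition hexp (m i n : nat) : nat :=
  n * (2 * k * (m + n) + 2 * (k - i) + 1).

(** The [evenP] factor is the quotient of (q^2; q^2)_oo by (q^2; q^2)_n (q^(2m+2n+2); q^2)_oo. The
    q^(-n) of (-1/q)^n is absorbed in [hexp]. *)
Definition hcoef m n : R :=
  (-1) ^+ n * oddP 0 n * oddP (m + n).+1 N * evenP n.+1 (m + n).+1.

Definition hsum m i : R :=
  \sum_(0 <= n < N) hcoef m n * q ^+ hexp m i n *
    (1 - q ^+ (2 * i * (m + 1 + 2 * n))).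

Definition jsum m i : R := hsum m i + q ^+ (2 * m + 1) * hsum m i.-1.

Lemma hsum0 m : hsum m 0 = 0.
Proof. by rewrite /hsum big1 // => n _; rewrite muln0 mul0n subrr mulr0. Qed.

(** Andrews' relation H_{k,i+1} - H_{k,i} = x^i J_{k,k-i}. Each difference of terms splits as
    [u n + v n]; after replacing [u n] by [u n.+1], the factors 1 - q^(2n+2) and 1 - q^(2(m+n+1))
    each complete the [evenP] product of [hcoef m.+1 n]. *)
Lemma hsumS m i r : k = (i + r).+1 ->
  hsum m i.+1 - hsum m i = q ^+ (2 * m.+1 * i) * jsum m.+1 r.+1.
Proof.
move=> Dk; rewrite /jsum /hsum -sumrB mulrDr !mulr_sumr -big_split /=.
pose u n := hcoef m n * q ^+ hexp m i.+1 n * (1 - q ^+ (2 * n)).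
pose v n := hcoef m n * q ^+ hexp m i.+1 n *
  q ^+ (2 * i * m.+1 + 2 * n * (2 * i + 1)) * (1 - q ^+ (2 * (m + n).+1)).
have Euv n : hcoef m n * q ^+ hexp m i.+1 n *
    (1 - q ^+ (2 * i.+1 * (m + 1 + 2 * n))) -
    hcoef m n * q ^+ hexp m i n * (1 - q ^+ (2 * i * (m + 1 + 2 * n))) =
    u n + v n.
  have e1 : hexp m i n = (hexp m i.+1 n + 2 * n)%N by rewrite /hexp; nia.
  have e2 : (2 * i.+1 * (m + 1 + 2 * n) =
    2 * i * m.+1 + 2 * n * (2 * i + 1) + 2 * (m + n).+1)%N by nia.
  have e3 : (2 * i * m.+1 + 2 * n * (2 * i + 1) =
     2 * n + 2 * i * (m + 1 + 2 * n))%N by nia.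
  by rewrite /u /v e1 e2 e3 !exprD; ring.
under eq_bigr do rewrite Euv.
rewrite big_split /=.
(* The shift costs nothing: [u 0] contains 1 - q^0, and the exponent in [u N] is at least [N]. *)
have -> : \sum_(0 <= n < N) u n = \sum_(0 <= n < N) u n.+1.
  have u0 : u 0 = 0 by rewrite /u muln0 expr0 subrr mulr0.
  have uN : u N = 0.
    by rewrite /u (@nilpotent_expr0 (hexp _ _ _)) ?mulr0 ?mul0r // /hexp; nia.
  transitivity (\sum_(0 <= n < N.+1) u n).
    by rewrite big_nat_recr //= uN addr0.
  by rewrite big_nat_recl //= u0 add0r.
rewrite -big_split /=; apply: eq_bigr => n _.
have eC : u n.+1 = - (hcoef m.+1 n * (1 + q ^+ (2 * n + 1)) * q ^+ hexp m i.+1 n.+1).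
  rewrite /u /hcoef addnS addSn (@evenPl n.+1) ?ltnS ?leq_addl //.
  by rewrite oddPr exprS; ring.
have eD : v n = hcoef m.+1 n * (1 + q ^+ (2 * (m + n).+1 + 1)) * q ^+ hexp m i.+1 n *
  q ^+ (2 * i * m.+1 + 2 * n * (2 * i + 1)).
  rewrite /v /hcoef addSn (@evenPr n.+1 (m + n).+1) ?ltnS ?leq_addl //.
  by rewrite (oddPl (m + n).+1); ring.
rewrite eC eD /=.
have f1 : (hexp m i.+1 n.+1 = hexp m.+1 r.+1 n + 2 * m.+1 * i +
   2 * r * (m.+1 + 1 + 2 * n) + 2 * (m + n).+1 + 1)%N.
  by rewrite /hexp Dk; nia.
have f2 : (hexp m i.+1 n + (2 * i * m.+1 + 2 * n * (2 * i + 1)) =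
   hexp m.+1 r.+1 n + 2 * m.+1 * i)%N by rewrite /hexp Dk; nia.
have f3 : (hexp m.+1 r n = hexp m.+1 r.+1 n + 2 * n)%N.
  by rewrite /hexp; nia.
have f4 : (2 * r.+1 * (m.+1 + 1 + 2 * n) = 
  2 * r * (m.+1 + 1 + 2 * n) + 2 * (m + n).+1 + 1 + (2 * n + 1))%N by nia.
have f5 : (2 * (m + n).+1 = 2 * m.+1 + 2 * n)%N by lia.
rewrite -[X in _ + X]mulrA -exprD f2 f3 f4 f1 !exprD f5 !exprD.
ring.
Qed.

(** As [hsum m 0 = 0], [hsumS] telescopes: the first sum is [hsum m i], the second is q^(2m+1) times
    [hsum m i.-1]. *)
Lemma jsum_rec m i : (0 < i <= k)%N ->
  jsum m i = \sum_(0 <= s < i) q ^+ (2 * m.+1 * s) * jsum m.+1 (k - s)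
    + \sum_(0 <= s < i.-1) q ^+ (2 * m.+1 * s + (2 * m + 1)) * jsum m.+1 (k - s).
Proof.
case: i => // i /= ltik; elim: i ltik => [|i IHi] ltik.
  rewrite [X in _ + X]big_geq // big_nat1 addr0 {1}/jsum /= hsum0 mulr0 addr0 subn0.
  have -> : jsum m.+1 k = hsum m 1 - hsum m 0.
    by rewrite (@hsumS _ 0 k.-1) ?prednK // muln0 mul1r.
  by rewrite hsum0 subr0 muln0 mul1r.
have [r Dk] : exists r, k = (i.+1 + r).+1 by exists (k - i.+2)%N; lia.
have Dk' : k = (i + r.+1).+1 by rewrite Dk addSnnS.
rewrite big_nat_recr // [X in _ + X]big_nat_recr //= addrACA -IHi 1?ltnW //.
have -> : (k - i.+1 = r.+1)%N by lia.
have -> : (k - i = r.+2)%N by lia.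
rewrite exprD mulrAC -(hsumS m Dk) -(hsumS m Dk').
by rewrite /jsum /=; ring.
Qed.

(* The sum over s = number of parts 2m+2, without and with a part 2m+1; the
   fuel f limits the parts to at most 2(m+f). *)
Fixpoint gser f m i : R := if f is f'.+1 then
    \sum_(0 <= s < i) q ^+ (2 * m.+1 * s) * gser f' m.+1 (k - s)%N
    + \sum_(0 <= s < i.-1) q ^+ (2 * m.+1 * s + (2 * m + 1)) * gser f' m.+1 (k - s)%N
  else 1.

Lemma nilpotency_gt0 : (0 < N)%N.
Proof.
by case: N qN0 => // /eqP; rewrite expr0 oner_eq0.
Qed.

Lemma evenP_stable b : (N <= b)%N -> evenP 1 b = evenP 1 N.
Proof.
move=> leNb; rewrite /evenP (big_cat_nat nilpotency_gt0 leNb) /= [X in _ * X]big_nat_cond.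
rewrite [X in _ * X]big1 ?mulr1 // => j /andP[/andP[leNj _] _].
by rewrite nilpotent_expr0 ?subr0 //; lia.
Qed.

(** This plays the role of the limit J -> 1: for such [m] only the term [n = 0] survives. *)
Lemma jsum_large m i : (0 < i <= k)%N -> (N <= m)%N -> jsum m i = evenP 1 N.
Proof.
case/andP=> i_gt0 leik leNm.
rewrite /jsum (@nilpotent_expr0 (2 * m + 1)) ?mul0r ?addr0; last lia.
rewrite /hsum big_ltn ?nilpotency_gt0 // big_nat_cond big1 ?addr0 => [|n /andP[/andP[n_gt0 _] _]].
  rewrite /hcoef /oddP addn0 !big_geq ?leqW // /hexp mul0n !mulr1 !mul1r.
  rewrite (@nilpotent_expr0 (2 * i * _)) ?subr0 ?mulr1 ?evenP_stable ?leqW //.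
  by have := leq_pmull m i_gt0; lia.
rewrite (@nilpotent_expr0 (hexp _ _ _)) ?mulr0 ?mul0r // /hexp.
apply: leq_trans (leq_pmull _ n_gt0).
have := leq_pmull (m + n) (leq_trans i_gt0 leik); lia.
Qed.

Lemma jsum_gser f m i : (0 < i <= k)%N -> (N <= m + f)%N ->
  jsum m i = evenP 1 N * gser f m i.
Proof.
elim: f m i => [|f IHf] m i Hi leN.
  by rewrite mulr1 jsum_large // -(addn0 m).
rewrite (jsum_rec _ Hi) /= mulrDr !mulr_sumr !big_seq.
by congr (_ + _); apply: eq_bigr => s; rewrite mem_index_iota => Hs;
  rewrite mulrCA -IHf //; lia.
Qed.

(** With E = q^(2n+1) and W = E^(2i-2), the two series contribute (1 - W E^2) + E (1 - W) = (1 +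
    E)(1 - W E) to the n-th term. The factor 1 + E is exactly the one missing from [hcoef 0 n] to
    make up [oddP 0 N]. *)
Lemma jsum0 i : (0 < i <= k)%N ->
  jsum 0 i = oddP 0 N * \sum_(0 <= n < N) (-1) ^+ n *
     q ^+ hexp 0 i n * (1 - q ^+ ((2 * n + 1) * (2 * i - 1))).
Proof.
case: i => // i /= ltik.
rewrite /jsum /hsum !mulr_sumr -big_split /= !big_seq.
apply: eq_bigr => n; rewrite mem_index_iota => /= ltnN.
have Dodd : oddP 0 N = oddP 0 n * (1 + q ^+ (2 * n + 1)) * oddP n.+1 N.
  by rewrite -oddPr /oddP -big_cat_nat.
rewrite Dodd /hcoef add0n /evenP (@big_geq _ _ _ n.+1 n.+1) // mulr1.
have -> : (hexp 0 i n = hexp 0 i.+1 n + 2 * n)%N by rewrite /hexp; nia.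
have -> : (2 * i.+1 * (0 + 1 + 2 * n) = 2 * i * (2 * n + 1) + (2 * n + 1) + (2 * n + 1))%N by nia.
have -> : (2 * i * (0 + 1 + 2 * n) = 2 * i * (2 * n + 1))%N by nia.
have -> : ((2 * n + 1) * (2 * i.+1 - 1) = 2 * i * (2 * n + 1) + (2 * n + 1))%N by nia.
by rewrite !exprD !muln0; ring.
Qed.

(** * The infinite product and its residue classes *)

Lemma oddP_stable b : (N <= b)%N -> oddP 0 b = oddP 0 N.
Proof.
move=> leNb; rewrite /oddP (big_cat_nat (leq0n N) leNb) /= [X in _ * X]big_nat_cond.
rewrite [X in _ * X]big1 ?mulr1 // => j /andP[/andP[leNj _] _].
by rewrite nilpotent_expr0 ?addr0 //; lia.
Qed.

Lemma prod_blocks n M (P : pred nat) (F : nat -> R) :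
  \prod_(0 <= j < M * n | P j) F j =
  \prod_(0 <= t < M) \prod_(0 <= r < n | P (t * n + r)%N) F (t * n + r)%N.
Proof.
elim: M => [|M IHM]; first by rewrite mul0n !big_geq.
rewrite big_nat_recr //= -IHM (@big_cat_nat _ _ _ (M * n)) ?leq_mul //=.
congr (_ * _); rewrite -[X in \prod_(X <= _ < _ | _) _]add0n big_addn mulSn addnK.
by apply: eq_big => r; rewrite addnC.
Qed.

(** Here [i] stands for k - i + 1 of the theorem, which turns the residues 2k - (2i - 1) and 2k +
    (2i - 1) into 2i - 1 and its negative modulo 4k. *)
Definition excluded i (m : nat) : bool :=
  (m %% (4 * k) \in [:: 0; 2 * i - 1; 4 * k - (2 * i - 1)])%N.

Lemma prod_excluded i M : (0 < i <= k)%N ->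
  \prod_(0 <= t < M * (4 * k) | excluded i t.+1) (1 - q ^+ t.+1) =
  \prod_(0 <= t < M) (1 - q ^+ (4 * k * t.+1 - (2 * i - 1))) *
  \prod_(0 <= t < M) (1 - q ^+ (4 * k * t + (2 * i - 1))) *
  \prod_(0 <= t < M) (1 - q ^+ (4 * k * t.+1)).
Proof.
move=> Hi; rewrite prod_blocks -!big_split /=; apply: eq_bigr => t _.
rewrite -big_filter.
(* The index is one less than the part, so the residue 0 occurs at the end of the block, at
   [r = 4 * k - 1]. *)
have Dr : perm_eq [seq r <- index_iota 0 (4 * k) | excluded i (t * (4 * k) + r).+1]
   [:: 4 * k - (2 * i - 1) - 1; 2 * i - 2; 4 * k - 1]%N.
  apply: uniq_perm; first by rewrite filter_uniq ?iota_uniq.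
    by rewrite /= !inE; lia.
  move=> r; rewrite mem_filter mem_index_iota /excluded -addnS modnMDl !inE.
  have [ltr4k|le4kr] := ltnP r (4 * k); last by lia.
  have [->|ner] := eqVneq r (4 * k - 1)%N.
    rewrite (_ : (4 * k - 1).+1 = 4 * k)%N ?modnn; lia.
  by rewrite modn_small; lia.
rewrite (perm_big _ Dr) /= !big_cons big_nil mulr1 -mulrA.
by congr ((1 - q ^+ _) * ((1 - q ^+ _) * (1 - q ^+ _))); nia.
Qed.

(** Each odd factor 1 - q^t meets 1 + q^t and becomes 1 - q^(2t), which supplies the missing even
    exponents, those congruent to 2 modulo 4. *)
Lemma prod_not2mod4 K : (N <= K)%N ->
  \prod_(0 <= t < K * 4 | (t.+1 %% 4 != 2)%N) (1 - q ^+ t.+1) * oddP 0 N = evenP 1 N.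
Proof.
move=> leNK; rewrite -(oddP_stable (leq_trans leNK (leq_pmulr K (isT : 0 < 2)%N))).
have -> : evenP 1 N = \prod_(0 <= j < K * 2) (1 - q ^+ (2 * j.+1)).
  rewrite -(@evenP_stable (K * 2).+1); last lia.
  by rewrite /evenP big_add1.
rewrite /oddP !prod_blocks -big_split /=.
have E4 s : \prod_(0 <= r < 4 | ((s * 4 + r).+1 %% 4 != 2)%N) (1 - q ^+ (s * 4 + r).+1) =
   (1 - q ^+ (s * 4 + 1)) * (1 - q ^+ (s * 4 + 3)) * (1 - q ^+ (s * 4 + 4)).
  rewrite -big_filter /index_iota /= -!addnS !modnMDl /= !big_cons big_nil.
  by rewrite !addnS !addn0 mulr1 mulrA.
have E2 s (F : nat -> R) : \prod_(0 <= r < 2) F (s * 2 + r)%N = F (s * 2)%N * F (s * 2).+1.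
  by rewrite /index_iota /= !big_cons big_nil mulr1 addn0 addn1.
transitivity (\prod_(0 <= s < K * 2) (1 - q ^+ (2 * (2 * s + 1))) *
              \prod_(0 <= s < K) (1 - q ^+ (s * 4 + 4))).
  rewrite prod_blocks -big_split; apply: eq_bigr => s _ /=.
  rewrite E4 (E2 s (fun j => 1 - q ^+ (2 * (2 * j + 1)))).
  rewrite (E2 s (fun j => 1 + q ^+ (2 * j + 1))).
  have -> : (2 * (s * 2) + 1 = s * 4 + 1)%N by lia.
  have -> : (2 * (s * 2).+1 + 1 = s * 4 + 3)%N by lia.
  by rewrite !mul2n -!addnn !exprD; ring.
(* Doubling the exponents made this product twice too long; the factors from [K] on are 1. *)
have -> : \prod_(0 <= s < K * 2) (1 - q ^+ (2 * (2 * s + 1))) =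
          \prod_(0 <= s < K) (1 - q ^+ (2 * (2 * s + 1))).
  rewrite (prod_1subX_stable (e := fun s => 2 * (2 * s + 1))%N); try lia.
  by rewrite -(@prod_1subX_stable _ K) //; lia.
rewrite -big_split; apply: eq_bigr => s _; rewrite (E2 s (fun j => 1 - q ^+ (2 * j.+1))) /=.
by congr ((1 - q ^+ _) * (1 - q ^+ _)); lia.
Qed.

Definition allowed i m : bool := (m %% 4 != 2)%N && ~~ excluded i m.

(** Multiplied by (q^2; q^2)_oo, the series is (-q; q^2)_oo times a theta series, and the triple
    product with [c = 2 * k], [a = 2 * i - 1] makes the latter the product over excluded parts.
    Together with the allowed parts this covers everything not 2 modulo 4, and [prod_not2mod4]
    returns (q^2; q^2)_oo, which cancels. *)
Lemma gser_inv f i : (0 < i <= k)%N -> (N <= f)%N ->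
  gser f 0 i * \prod_(0 <= t < 2 * N * (4 * k) | allowed i t.+1) (1 - q ^+ t.+1) = 1.
Proof.
move=> Hi leNf.
set A := \prod_(_ <= _ < _ | _) _.
have evenP_reg : GRing.lreg (evenP 1 N).
  rewrite /evenP big_nat_cond; apply: lreg_prod => j /andP[/andP[j_gt0 _] _].
  by apply: lreg_1subX; lia.
apply: (evenP_reg); rewrite mulr1 mulrA -jsum_gser // jsum0 //.
have -> : \sum_(0 <= n < N) (-1) ^+ n * q ^+ hexp 0 i n *
     (1 - q ^+ ((2 * n + 1) * (2 * i - 1))) =
   \prod_(0 <= t < 2 * N * (4 * k) | excluded i t.+1) (1 - q ^+ t.+1).
  rewrite prod_excluded // (_ : 4 * k = 2 * (2 * k))%N; last lia.
  rewrite triple_product //; last lia.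
  apply: eq_bigr => n _; congr (_ * q ^+ _ * _).
  by rewrite /hexp; nia.
rewrite -mulrA.
have -> : \prod_(0 <= t < 2 * N * (4 * k) | excluded i t.+1) (1 - q ^+ t.+1) * A =
   \prod_(0 <= t < 2 * N * (4 * k) | (t.+1 %% 4 != 2)%N) (1 - q ^+ t.+1).
  rewrite [RHS](bigID (fun t => excluded i t.+1)) /=; congr (_ * _).
  (* An excluded number is odd or divisible by 4, hence never 2 modulo 4. *)
  apply: eq_bigl => t; apply/esym/andb_idl.
  rewrite /excluded !inE.
  by move=> E; nia.
rewrite mulrC (_ : 2 * N * (4 * k) = (2 * N * k) * 4)%N; last lia.
by apply: prod_not2mod4; nia.
Qed.

End NilpotentSeries.

(** * Multiplicities in nonincreasing sequences *)

Lemma count_mem_filter (T : eqType) (p : pred T) (s : seq T) x :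
  count_mem x (filter p s) = if p x then count_mem x s else 0.
Proof.
rewrite count_filter; case: ifP => px; last first.
  by rewrite -(count_pred0 s); apply: eq_count => y /=; apply/andP => -[/eqP->]; rewrite px.
by apply: eq_count => y /=; apply: andb_idr => /eqP->.
Qed.

Lemma sorted_geq_cat s t :
  sorted geq (s ++ t) = [&& allrel geq s t, sorted geq s & sorted geq t].
Proof.
have tr : transitive geq by move=> y x z /= xy yz; exact: leq_trans yz xy.
by rewrite !(sorted_pairwise tr) pairwise_cat.
Qed.

Lemma sorted_geq_nseq n x : sorted geq (nseq n x).
Proof. by elim: n => //= -[|n] //= ->; rewrite leqnn. Qed.

Lemma sorted_geq_split b x : sorted geq b ->
  b = [seq c <- b | x < c] ++ nseq (count_mem x b) x ++ [seq c <- b | c < x].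
Proof.
move=> sb.
have tr : transitive geq by move=> y z t /= yz tz; exact: leq_trans tz yz.
have an : antisymmetric geq by move=> y z /=; rewrite andbC => /anti_leq.
apply: (sorted_eq tr an) => //.
  rewrite !sorted_geq_cat sorted_geq_nseq !(sorted_filter tr) //= !andbT.
  rewrite allrel_catr -andbA; apply/and3P; split; apply/allrelP => y z.
  - by rewrite mem_filter mem_nseq => /andP[/ltnW ? _] /andP[_ /eqP->].
  - by rewrite !mem_filter => /andP[ltxy _] /andP[ltzx _]; rewrite /= ltnW // (ltn_trans ltzx).
  - by rewrite mem_filter mem_nseq => /andP[_ /eqP->] /andP[/ltnW].
apply/allP => y _; apply/eqP.
rewrite !count_cat !count_mem_filter count_nseq /= eq_sym.
by case: ltngtP => [||<-]; rewrite ?mul1n ?mul0n ?addn0 ?add0n.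
Qed.

(** * Enumeration of the partitions with difference conditions *)

Section GordonEnumeration.

Variable k : nat.

Record gordon_above (f m i : nat) (b : seq nat) : Prop := GordonAbove {
  ga_sorted : sorted geq b;
  ga_range : forall c, c \in b -> 2 * m < c <= 2 * (m + f);
  ga_odd : forall j, count_mem (2 * j + 1) b <= 1;
  ga_window : forall j, count_mem (2 * j) b + count_mem (2 * j + 1) b
                        + count_mem (2 * j + 2) b < k;
  ga_first : count_mem (2 * m + 1) b + count_mem (2 * m + 2) b < i }.

(** Follows the recursion of [gser]. Once [s] parts 2m+2 are chosen, the window 2m+2, 2m+3, 2m+4
    leaves room for fewer than [k - s] parts 2m+3 or 2m+4; a part 2m+1 lies outside that window. *)
Fixpoint gordon_enum f m i : seq (seq nat) := if f is f'.+1 then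
  [seq b ++ nseq s (2 * m + 2) | s <- index_iota 0 i,
                                 b <- gordon_enum f' m.+1 (k - s)] ++
  [seq b ++ nseq s (2 * m + 2) ++ [:: 2 * m + 1] |
     s <- index_iota 0 i.-1, b <- gordon_enum f' m.+1 (k - s)]
  else [:: [::]].

(** Only two windows see the added parts: the one at [m] contains s + e < i <= k parts, and the one
    at [m.+1] is controlled by the bound [k - s] on [b]. *)
Lemma gordon_above_cat f m i b s e : s + e < i <= k -> e <= 1 ->
  gordon_above f m.+1 (k - s) b ->
  gordon_above f.+1 m i (b ++ nseq s (2 * m + 2) ++ nseq e (2 * m + 1)).
Proof.
move=> Hi He [sb rb ob wb fb].
have cnt0 x : x <= 2 * m + 2 -> count_mem x b = 0.
  by move=> lex; apply/count_memPn/negP => /rb; lia.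
set b' := b ++ _.
have cntE x : count_mem x b' =
   count_mem x b + (2 * m + 2 == x) * s + (2 * m + 1 == x) * e.
  by rewrite !count_cat !count_nseq addnA.
have cnt_lt x : x < 2 * m + 1 -> count_mem x b' = 0.
  by move=> ltx; rewrite cntE cnt0 ?(gtn_eqF (n := x)) ?(ltn_addr 1) //; lia.
have cnt_gt x : 2 * m + 2 < x -> count_mem x b' = count_mem x b.
  by move=> ltx; rewrite cntE !ltn_eqF ?addn0 //; lia.
have cnt1 : count_mem (2 * m + 1) b' = e.
  by rewrite cntE cnt0 ?eqxx ?gtn_eqF //; lia.
have cnt2 : count_mem (2 * m + 2) b' = s.
  by rewrite cntE cnt0 ?eqxx ?ltn_eqF //; lia.
split.
- rewrite !sorted_geq_cat !sorted_geq_nseq sb !andbT allrel_catr /=.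
  apply/andP; split; [apply/andP; split|]; apply/allrelP => x y.
  + by move=> /rb ? /nseqP[-> _] /=; lia.
  + by move=> /rb ? /nseqP[-> _] /=; lia.
  + by move=> /nseqP[-> _] /nseqP[-> _] /=; lia.
- by move=> c; rewrite !mem_cat => /or3P[/rb|/nseqP[-> _]|/nseqP[-> _]]; lia.
- move=> j; have [ltjm|ltmj|->] := ltngtP j m; last by rewrite cnt1.
    by rewrite cnt_lt //; lia.
  by rewrite cnt_gt ?ob //; lia.
- move=> j; have [ltjm|ltmj|->] := ltngtP j m; last first.
  + by rewrite (cnt_lt (2 * m)) ?cnt1 ?cnt2; lia.
  + have [lemj|ltjm'] := leqP j m.+1; last by rewrite !cnt_gt ?wb //; lia.
    have -> : j = m.+1 by lia.
    rewrite (cnt_gt (2 * m.+1 + 1)) ?(cnt_gt (2 * m.+1 + 2)); try lia.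
    by rewrite (_ : 2 * m.+1 = 2 * m + 2) ?cnt2 in fb *; lia.
  + have [ltj|eqj] : j.+1 < m \/ j.+1 = m by lia.
      by rewrite !cnt_lt; lia.
    by rewrite !cnt_lt; lia.
- by rewrite cnt1 cnt2; lia.
Qed.

Lemma gordon_above_split f m i b : 0 < i <= k -> gordon_above f.+1 m i b ->
  exists b' s e, [/\ b = b' ++ nseq s (2 * m + 2) ++ nseq e (2 * m + 1),
    s + e < i, e <= 1 & gordon_above f m.+1 (k - s) b'].
Proof.
move=> Hi [sb rb ob wb fb].
exists [seq c <- b | 2 * m + 2 < c], (count_mem (2 * m + 2) b), (count_mem (2 * m + 1) b).
split; [|lia|exact: ob|split].
- rewrite {1}[b](sorted_geq_split (2 * m + 2) sb); congr (_ ++ (_ ++ _)).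
  rewrite (eq_in_filter (a2 := pred1 (2 * m + 1))).
    rewrite -size_filter; apply/all_pred1P/allP => c.
    by rewrite mem_filter => /andP[].
  by move=> c /rb /=; lia.
- by apply: sorted_filter => // y x z /= xy yz; exact: leq_trans yz xy.
- by move=> c; rewrite mem_filter => /andP[? /rb]; lia.
- by move=> j; rewrite count_mem_filter; case: ifP.
- move=> j; rewrite !count_mem_filter; have := wb j.
  by do 3![case: ifP => _]; lia.
- rewrite !count_mem_filter; have := wb m.+1.
  rewrite (_ : 2 * m.+1 = 2 * m + 2); last lia.
  by rewrite !ifT; lia.
Qed.

Lemma gordon_enumP f m i b : 0 < i <= k ->
  reflect (gordon_above f m i b) (b \in gordon_enum f m i).
Proof.
elim: f m i b => [|f IHf] m i b Hi.
  rewrite inE; apply: (iffP eqP) => [->|[_ rb _ _ _]].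
    by split=> //= *; lia.
  by case: b rb => // c b /(_ c); rewrite mem_head => /(_ isT); lia.
rewrite /= mem_cat; apply: (iffP orP) => [|gb].
  case=> /allpairsPdep[s [b' [+ + ->]]]; rewrite mem_index_iota => Hs /IHf gb'.
    rewrite -[nseq s _]cats0; apply: (@gordon_above_cat _ _ _ _ _ 0) => //; first lia.
    by apply: gb'; lia.
  apply: (@gordon_above_cat _ _ _ _ _ 1) => //; first lia.
  by apply: gb'; lia.
have [b' [s [e [-> Hs He /IHf gb']]]] := gordon_above_split Hi gb.
case: e He Hs => [|[|]] // _ Hs; [left|right]; apply/allpairsPdep; exists s, b'.
  by rewrite mem_index_iota gb' ?cats0; [split=> //; lia | lia].
by rewrite mem_index_iota gb'; [split=> //; lia | lia].
Qed.

(** The multiplicity of 2m+2 recovers [s], and that of 2m+1 tells which of the two lists an element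
    comes from. *)
Lemma gordon_enum_uniq f m i : 0 < i <= k -> uniq (gordon_enum f m i).
Proof.
elim: f m i => //= f IHf m i Hi.
have cnt0 s b x : s < k -> b \in gordon_enum f m.+1 (k - s) -> x <= 2 * m + 2 ->
    count_mem x b = 0.
  move=> ltsk /gordon_enumP gb lex; apply/count_memPn/negP => xb.
  by case: gb => [|_ /(_ x xb) + _ _ _]; lia.
have uniq_aux (t : seq nat) i' : i' <= i ->
    uniq [seq b ++ nseq s (2 * m + 2) ++ t |
            s <- index_iota 0 i', b <- gordon_enum f m.+1 (k - s)].
  move=> lei; apply: allpairs_uniq_dep; first exact: iota_uniq.
    by move=> s; rewrite mem_index_iota => ?; apply: IHf; lia.
  move=> _ _ /allpairsPdep[s1 [b1 [+ b1E ->]]] /allpairsPdep[s2 [b2 [+ b2E ->]]] /=.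
  rewrite !mem_index_iota => Hs1 Hs2 E.
  have Es : s1 = s2.
    have /(congr1 (count_mem (2 * m + 2))) := E.
    rewrite !count_cat !count_nseq /= eqxx (cnt0 _ _ _ _ b1E) ?(cnt0 _ _ _ _ b2E); lia.
  move: E; rewrite Es => E.
  have Esz : size b1 = size b2.
    by have := congr1 size E; rewrite 2!(size_cat _ (_ ++ _)) => /addIn.
  by move/eqP: E; rewrite (eqseq_cat _ _ Esz) => /andP[/eqP->].
rewrite cat_uniq uniq_aux ?leq_pred // andbT.
rewrite -[X in uniq X](_ : [seq b ++ nseq s (2 * m + 2) ++ [::] |
   s <- index_iota 0 i, b <- gordon_enum f m.+1 (k - s)] = _); last first.
  by apply: eq_allpairs => s b; rewrite cats0.
rewrite uniq_aux //=; apply/hasPn => _ /allpairsPdep[s1 [b1 [+ b1E ->]]].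
rewrite mem_index_iota => Hs1; apply/allpairsPdep => -[s2 [b2 [+ b2E]]].
rewrite mem_index_iota => Hs2 /(congr1 (count_mem (2 * m + 1))).
rewrite !count_cat !count_nseq /= eqxx (cnt0 _ _ _ _ b1E) ?(cnt0 _ _ _ _ b2E); lia.
Qed.
End GordonEnumeration.

(** * From differences at distance k - 1 to multiplicities *)

(** In a nonincreasing sequence the entries that are at least [x] form an initial segment. *)
Lemma leq_nth_count b x p : sorted geq b -> p < size b ->
  (x <= nth 0 b p) = (p < count (leq x) b).
Proof.
elim: b p => //= c b IHb p sb.
have tr : transitive geq by move=> y z t /= yz tz; exact: leq_trans tz yz.
have ltb := order_path_min tr sb; have {}IHb := IHb _ (path_sorted sb).
have [lexc|ltcx] := leqP x c.
  by case: p => [|p] //=; rewrite ltnS => /IHb->.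
have cnt0 : count (leq x) b = 0.
  apply/eqP; rewrite -leqn0 leqNgt -has_count; apply/hasPn => y /(allP ltb) /=; lia.
rewrite cnt0; case: p => [|p] /=; first lia.
by rewrite ltnS => /IHb->; rewrite cnt0.
Qed.

Lemma window_count b lo hi k : sorted geq b -> 0 < k -> lo <= hi ->
  reflect (exists2 p, p + k.-1 < size b &
             (nth 0 b p <= hi) && (lo <= nth 0 b (p + k.-1)))
          (k <= count (fun c => lo <= c <= hi) b).
Proof.
move=> sb k_gt0 lelohi.
have Dcnt : count (leq lo) b = count (fun c => lo <= c <= hi) b + count (leq hi.+1) b.
  by elim: (b) => //= c b' ->; lia.
apply: (iffP idP) => [lek|[p ltp /andP[lehi lelo]]].
  have ltp : count (leq hi.+1) b + k.-1 < count (leq lo) b by lia.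
  have ltp' := leq_trans ltp (count_size _ _).
  (* The number of entries above [hi] is the first position whose entry is at most [hi]. *)
  exists (count (leq hi.+1) b) => //; apply/andP; split; last by rewrite leq_nth_count.
  by rewrite leqNgt leq_nth_count ?ltnn //; lia.
have ltp' : p < size b by lia.
move: lelo; rewrite leq_nth_count //; move: lehi; rewrite leqNgt leq_nth_count //; lia.
Qed.

Lemma count_three b j :
  count_mem (2 * j) b + count_mem (2 * j + 1) b + count_mem (2 * j + 2) b =
  count (fun c => 2 * j <= c <= 2 * j + 2) b.
Proof. by elim: b => //= c b <-; lia. Qed.

(** A first part 2j+1 with difference at most 1, or 2j+2 with difference at most 2, violates the
    condition; in both cases the last part is at least 2j, so [k] consecutive parts lie between 2j
    and 2j+2. *)
Lemma difference_partsP k b : sorted geq b -> 0 \notin b -> 0 < k ->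
  reflect (forall j, count_mem (2 * j) b + count_mem (2 * j + 1) b
                     + count_mem (2 * j + 2) b < k)
          (difference_parts k b).
Proof.
move=> sb b0 k_gt0; apply: (iffP forallP) => [db j|cb [p ltp]].
  rewrite count_three ltnNge; apply/negP => /(window_count sb k_gt0).
  case=> [|p ltp /andP[lehi lelo]]; first lia.
  have ltp' : p < size b by lia.
  have /implyP/(_ ltp) /= := db (Ordinal ltp').
  by case: ifP; lia.
apply/implyP => /= ltp'.
have v_gt0 : 0 < nth 0 b p by rewrite lt0n; apply: contraNneq b0 => <-; apply: mem_nth.
have Hcb j : ~~ ((nth 0 b p <= 2 * j + 2) && (2 * j <= nth 0 b (p + k.-1))).
  apply/negP => Hp; have := cb j; rewrite count_three ltnNge => /negP; apply.
  by apply/window_count => //; [lia | exists p].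
move: (nth 0 b p) (nth 0 b (p + k.-1)) v_gt0 Hcb => v w v_gt0 Hcb.
(* Positivity of [v] allows a window with [v] among its upper two values. *)
have [j Dv] : exists j, v = 2 * j + 1 \/ v = 2 * j + 2.
  by exists (v.-1 %/ 2); lia.
by have := Hcb j; case: Dv => ->; case: ifP; lia.
Qed.

Lemma gordon_partsP k i n f b : 0 < i <= k -> is_part_of n b -> n <= f ->
  reflect (gordon_above k f 0 (k - i + 1) b) (gordon_parts k i b).
Proof.
move=> Hi /and3P[sb b0 /eqP Dn] lenf.
have k_gt0 : 0 < k by lia.
have cnt12 : count (pred2 1 2) b = count_mem 1 b + count_mem 2 b.
  by elim: (b) => //= c b' ->; lia.
rewrite /gordon_parts cnt12; apply: (iffP and3P) => [[ub db fb]|[_ rb ob wb fb]].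
  split=> // [c cb|j||]; last by rewrite muln0 !add0n; lia.
  - have := leq_part_sumn cb.
    have : 0 < c by rewrite lt0n; apply: contraNneq b0 => <-.
    lia.
  - rewrite (_ : count_mem _ b = count_mem (2 * j + 1) [seq c <- b | odd c]).
      by rewrite count_uniq_mem // leq_b1.
    by rewrite count_mem_filter ifT //; lia.
  - exact/difference_partsP.
split; last by move: fb; rewrite muln0 !add0n; lia.
- apply: count_mem_uniq => x; rewrite count_mem_filter mem_filter.
  case: ifP => // oddx; have := ob (x %/ 2).
  rewrite (_ : 2 * (x %/ 2) + 1 = x); last lia.
  by rewrite -has_pred1 has_count; case: (count_mem x b) => [|[]].
- exact/difference_partsP.
Qed.

(** * Enumeration of the partitions with prescribed parts *)

Section CongruenceEnumeration.

Variables (P : pred nat) (N : nat).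

(** Keeping multiplicities below [N] makes the list finite and loses nothing in the generating
    function, where q^N = 0. *)
Fixpoint part_enum J : seq (seq nat) := if J is j.+1 then
    if P j.+1 then [seq nseq s j.+1 ++ b | s <- index_iota 0 N, b <- part_enum j]
    else part_enum j
  else [:: [::]].

Lemma part_enumP J b : 0 < N ->
  reflect [/\ sorted geq b, forall c, c \in b -> (0 < c <= J) && P c
            & forall c, count_mem c b < N]
    (b \in part_enum J).
Proof.
move=> N_gt0; elim: J b => [|J IHJ] b /=.
  rewrite inE; apply: (iffP eqP) => [->|[_ rb _]]; first by [].
  by case: b rb => // c b /(_ c); rewrite mem_head => /(_ isT); lia.
case: ifP => PJ; last first.
  apply: (iffP (IHJ b)) => -[sb rb cb]; split=> // c /[dup] cin /rb.
    by case: (P c) => //; lia.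
  by have [-> |ne] := eqVneq c J.+1; [rewrite PJ andbF | case: (P c) => //; lia].
apply: (iffP allpairsPdep) => [[s [b' [+ /IHJ[sb rb cb] ->]]]|[sb rb cb]].
  rewrite mem_index_iota => Hs.
  have cnt0 : count_mem J.+1 b' = 0.
    by apply/count_memPn/negP => /rb; lia.
  split.
  - rewrite sorted_geq_cat sorted_geq_nseq sb !andbT.
    by apply/allrelP => x y /nseqP[-> _] /rb /=; lia.
  - move=> c; rewrite mem_cat => /orP[/nseqP[-> _]|/rb]; first by rewrite PJ; lia.
    by case: (P c); lia.
  - move=> c; rewrite count_cat count_nseq /=.
    case: eqP => [<-|_]; first by rewrite cnt0; lia.
    by rewrite mul0n cb.
exists (count_mem J.+1 b), [seq c <- b | c < J.+1]; split.
- by rewrite mem_index_iota cb.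
- apply/IHJ; split.
  + by apply: sorted_filter => // y x z /= xy yz; exact: leq_trans yz xy.
  + by move=> c; rewrite mem_filter => /andP[? /rb]; case: (P c); lia.
  + by move=> c; rewrite count_mem_filter; case: ifP => // _; rewrite cb.
- rewrite {1}[b](sorted_geq_split J.+1 sb).
  rewrite (_ : [seq c <- b | J.+1 < c] = [::]) //.
  apply/eqP; rewrite -[_ == _]negbK -has_filter; apply/hasPn => c /rb; lia.
Qed.

Lemma part_enum_uniq J : 0 < N -> uniq (part_enum J).
Proof.
move=> N_gt0; elim: J => //= J IHJ; case: ifP => // PJ.
apply: allpairs_uniq_dep => //; first exact: iota_uniq.
move=> _ _ /allpairsPdep[s1 [b1 [_ /part_enumP b1E ->]]] /allpairsPdep[s2 [b2 [_ /part_enumP b2E ->]]] /=.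
have [_ r1 _] := b1E N_gt0; have [_ r2 _] := b2E N_gt0 => E.
have cnt0 b : (forall c, c \in b -> (0 < c <= J) && P c) -> count_mem J.+1 b = 0.
  by move=> rb; apply/count_memPn/negP => /rb; lia.
have Es : s1 = s2.
  have := congr1 (count_mem J.+1) E.
  by rewrite !count_cat !count_nseq /= eqxx (cnt0 b1) // (cnt0 b2) //; lia.
move/eqP: E; rewrite Es eqseq_cat // eqxx /= => /eqP-> //.
Qed.

End CongruenceEnumeration.

(** * From cardinals to generating functions *)

Lemma card_intpart (n : nat) (P : pred (seq nat)) (E : seq (seq nat)) : uniq E ->
  (forall b, is_part_of n b -> P b = (b \in E)) ->
  (forall b, b \in E -> sumn b = n -> is_part_of n b) ->
  #|[set b : intpart n | P b]| = count (fun b => sumn b == n) E.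
Proof.
move=> uE PE partE; rewrite cardE -(size_map val) -size_filter; apply/perm_size/uniq_perm.
- by rewrite (map_inj_uniq val_inj) enum_uniq.
- exact: filter_uniq.
move=> b; rewrite mem_filter; apply/mapP/andP => [[c + ->]|[/eqP Db bE]].
  rewrite mem_enum inE => Pc; have pc := partsP c.
  by rewrite -PE // Pc; case/and3P: pc.
have pb := partE b bE Db.
by exists (IntPart pb); rewrite // mem_enum inE /= PE.
Qed.

Section GeneratingFunctions.

Local Open Scope ring_scope.

Variables (R : comNzRingType) (q : R).

Lemma sum_gordon_enum k f m i :
  \sum_(b <- gordon_enum k f m i) q ^+ sumn b = gser q k f m i.
Proof.
elim: f m i => [|f IHf] m i; first by rewrite big_seq1.
rewrite /= big_cat !big_allpairs_dep /=; congr (_ + _); apply: eq_bigr => s _;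
  rewrite -IHf mulr_sumr; apply: eq_bigr => b _; rewrite -exprD; congr (_ ^+ _).
  by rewrite sumn_cat sumn_nseq; lia.
by rewrite !sumn_cat sumn_nseq /=; lia.
Qed.

(** The truncated geometric sum of q^(js) over s < N is an exact inverse of 1 - q^j, since q^(jN) =
    0. *)
Lemma sum_part_enum N (P : pred nat) J : q ^+ N = 0 ->
  (\sum_(b <- part_enum P N J) q ^+ sumn b) *
    \prod_(0 <= t < J | P t.+1) (1 - q ^+ t.+1) = 1.
Proof.
move=> qN0; elim: J => [|J IHJ]; first by rewrite big_seq1 big_geq ?mulr1.
rewrite [X in _ * X]big_mkcond big_nat_recr //= -big_mkcond mulrA.
case: ifP => PJ; last by rewrite mulr1.
have -> : \sum_(b <- [seq nseq s J.+1 ++ b | s <- index_iota 0 N, b <- part_enum P N J])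
    q ^+ sumn b =
  (\sum_(s < N) q ^+ J.+1 ^+ s) * \sum_(b <- part_enum P N J) q ^+ sumn b.
  rewrite big_allpairs_dep big_mkord mulr_suml; apply: eq_bigr => s _.
  rewrite mulr_sumr; apply: eq_bigr => b _.
  by rewrite sumn_cat sumn_nseq exprD exprM.
rewrite -[X in X * _]mulrA IHJ mulr1 mulrC -opprB mulNr -subrX1.
by rewrite exprAC qN0 expr0n /= sub0r opprK.
Qed.

(** Both sums are inverses of the same product. *)
Lemma sum_gordon_part_enum k i N : q ^+ N = 0 -> (0 < i <= k)%N ->
  \sum_(b <- gordon_enum k N 0 i) q ^+ sumn b =
  \sum_(b <- part_enum (allowed k i) N (2 * N * (4 * k))) q ^+ sumn b.
Proof.
move=> qN0 Hi; rewrite sum_gordon_enum.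
rewrite -[LHS]mulr1 -(sum_part_enum (allowed k i) (2 * N * (4 * k)) qN0) mulrCA.
by rewrite (gser_inv qN0 Hi (leqnn N)) mulr1.
Qed.

End GeneratingFunctions.

(** * Reading off the coefficient of q^n *)

Section CoefficientComparison.

Local Open Scope ring_scope.

(** Reduction removes a multiple of X^(n+1), which has no term of degree n. *)
Lemma coef_in_qpolyXn (p : {poly int}) n : (in_qpoly 'X^(n.+1) p : {poly int})`_n = p`_n.
Proof.
rewrite /= mk_monic_Xn [in RHS](Pdiv.RingMonic.rdivp_eq (monicXn _ n.+1) p).
by rewrite coefD coefMXn ltnSn add0r.
Qed.

Lemma coef_sum_sumn (E : seq (seq nat)) n :
  (\sum_(b <- E) 'X^(sumn b) : {poly int})`_n = (count (fun b => sumn b == n) E)%:R.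
Proof.
rewrite coef_sum -sum1_count [RHS]natr_sum [RHS]big_mkcond.
by apply: eq_bigr => b _; rewrite coefXn eq_sym; case: eqP.
Qed.

Lemma count_gordon_part_enum k i n : (0 < i <= k)%N ->
  count (fun b => sumn b == n) (gordon_enum k n.+1 0 i) =
  count (fun b => sumn b == n) (part_enum (allowed k i) n.+1 (2 * n.+1 * (4 * k))).
Proof.
move=> Hi; apply/eqP; rewrite -(Num.Theory.eqr_nat int) -2!coef_sum_sumn.
apply/eqP; rewrite -[LHS]coef_in_qpolyXn -[RHS]coef_in_qpolyXn !rmorph_sum.
pose q := in_qpoly ('X^(n.+1) : {poly int}) 'X.
have DX (E : seq (seq nat)) :
    \sum_(b <- E) in_qpoly 'X^(n.+1) 'X^(sumn b) = \sum_(b <- E) q ^+ sumn b.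
  by apply: eq_bigr => b _; rewrite rmorphXn.
(* What remains is the nilpotency of the class of X. *)
rewrite 2!DX sum_gordon_part_enum // /q -rmorphXn; apply/val_eqP => /=.
by rewrite mk_monic_Xn Pdiv.RingMonic.rmodpp ?monicXn.
Qed.

End CoefficientComparison.

(** * Matching the residues, and conclusion *)

Lemma congruence_partsE k i b : 0 < i <= k ->
  congruence_parts k i b = all (allowed k (k - i + 1)) b.
Proof.
move=> Hi; apply: eq_all => c; rewrite /allowed /excluded !inE !negb_or.
rewrite mod0n (modn_small (m := 2)) //.
rewrite (modn_small (m := 2 * k + _)); last lia.
rewrite (modn_small (m := 2 * k - _)); last lia.
rewrite (_ : 4 * k - (2 * (k - i + 1) - 1) = 2 * k + (2 * i - 1)); last lia.
rewrite (_ : 2 * (k - i + 1) - 1 = 2 * k - (2 * i - 1)); last lia.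
by rewrite [(_ != _ + _) && _]andbC.
Qed.

Theorem theorem6p3 (k i n : nat) :
  1 <= k -> 1 <= i <= k ->
  #|[set b : intpart n | congruence_parts k i b]| =
  #|[set b : intpart n | gordon_parts k i b]|.
Proof.
move=> k_gt0 Hi; have Hi' : 0 < k - i + 1 <= k by lia.
(* The bounds of both enumerations are harmless: a partition of [n] has parts and multiplicities at
   most [n]. *)
rewrite (card_intpart (E := part_enum (allowed k (k - i + 1)) n.+1 (2 * n.+1 * (4 * k)))).
- rewrite (card_intpart (E := gordon_enum k n.+1 0 (k - i + 1))).
  + by rewrite count_gordon_part_enum.
  + exact: gordon_enum_uniq.
  + move=> b pb; apply/(sameP (gordon_partsP Hi pb (leqnSn n))).
    exact: gordon_enumP.
  + move=> b /(gordon_enumP _ _ _ Hi')[sb rb _ _ _] Db.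
    by rewrite /is_part_of sb Db eqxx andbT; apply/negP => /rb.
- exact: part_enum_uniq.
- move=> b /and3P[sb b0 /eqP Db]; rewrite congruence_partsE //.
  apply/allP/part_enumP => // [ab|[_ ab _] c /ab /andP[]//].
  split=> // c => [cb|].
    rewrite ab // andbT lt0n (leq_trans (leq_part_sumn cb)) ?andbT.
      by apply: contraNneq b0 => <-.
    by rewrite Db; nia.
  by rewrite ltnS -[X in _ <= X]Db (leq_trans (count_size _ _)) ?size_leq_sumn.
- move=> b /part_enumP[] // sb rb _ Db.
  by rewrite /is_part_of sb Db eqxx andbT; apply/negP => /rb.
Qed.
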